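(* Let $\rho$ be the current state and let $C_{\mathrm{reason}}:\ x_r+\sum_{j\in J}a_jx_j\ge b$ be a constraint in binary variables with $r\notin J$ and $a_j\ge0$ for all $j\in J$, which propagates $x_r$ in $\rho$ non-tightly. Let $P=\{j\in J:\ u^\rho_j=1\}$, $P_W=\{j\in P:\ a_j\notin\mathbb{Z}\}$ and $P_Z=\{j\in P:\ a_j\in\mathbb{Z}\}$. Then the constraint $$C_{\mathrm{cMIR}}:\quad x_r+\sum_{j\in J\setminus P}\psi(a_j)\,x_j-\sum_{j\in P}\psi(-a_j)\,x_j\ \ge\ 1-\sum_{j\in P}\psi(-a_j),\qquad \psi(a)=\lfloor a\rfloor+\min\Big\{1,\frac{f(a)}{f\big(b-\sum_{j\in P}a_j\big)}\Big\},$$ dominates the constraint $$C_{\mathrm{wMIR}}:\quad x_r+\sum_{j\in P_Z}a_jx_j+\sum_{j\in J\setminus P}\psi_w(a_j)\,x_j\ \ge\ \Big\lceil b-\sum_{j\in P_W}a_j\Big\rceil,\qquad \psi_w(a)=\lfloor a\rfloor+\min\Big\{1,\frac{f(a)}{f\big(b-\sum_{j\in P_W}a_j\big)}\Big\}.$$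
   Context: Setting: a pure binary program, i.e. all variables satisfy $x_j\in\{0,1\}$ with global bounds $\ell_j=0$, $u_j=1$. For real $t$, $f(t)=t-\lfloor t\rfloor$ denotes the fractional part. State: a state $\rho$ carries local bounds $\ell^\rho_j\le u^\rho_j$, all in $\{0,1\}$. Propagation: the bound on $x_r$ propagated by $C_{\mathrm{reason}}$ in $\rho$ is $$\beta:=b-\max\Big\{\sum_{j\in J}a_jx_j:\ \ell^\rho_j\le x_j\le u^\rho_j\ (j\in J)\Big\},$$ so that $x_r\ge\beta$ and, by integrality, $x_r\ge\lceil\beta\rceil$. ''$C_{\mathrm{reason}}$ propagates $x_r$ in $\rho$'' means that this raises the lower bound of the binary variable $x_r$ from $0$ to $1$, i.e. $\lceil\beta\rceil=1$; the propagation is non-tight if $\beta\notin\mathbb{Z}$ (so $0<\beta<1$). Dominance: a constraint $C''$ dominates a constraint $C'$ if every (real) point $\tilde x\in[\ell,u]$ (the box of global bounds, here $[0,1]^n$) that satisfies $C''$ also satisfies $C'$. *)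

(* Defs.v *)
From mathcomp Require Import all_boot all_order all_algebra archimedean.
From mathcomp Require Import classical_sets reals.

Set Implicit Arguments.
Unset Strict Implicit.
Unset Printing Implicit Defensive.

Import Order.TTheory GRing.Theory Num.Theory.
Local Open Scope classical_set_scope.
Local Open Scope ring_scope.

Definition fractional_part {R : realType} (t : R) : R := t - (Num.floor t)%:~R.

Record state (R : realType) (n : nat) := State {
  lb : 'rV[R]_n;
  ub : 'rV[R]_n;
  lb_binary : forall j, lb 0 j = 0 \/ lb 0 j = 1;
  ub_binary : forall j, ub 0 j = 0 \/ ub 0 j = 1;
  lb_le_ub : forall j, lb 0 j <= ub 0 j
}.

(* A constraint is represented by the set of real points satisfying it. *)
Definition constraint (R : realType) (n : nat) := set 'rV[R]_n.

Definition global_box {R : realType} {n : nat} : set 'rV[R]_n :=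
  [set x | forall j, 0 <= x 0 j <= 1].

Definition dominates {R : realType} {n : nat} (C'' C' : constraint R n) : Prop :=
  forall x, global_box x -> C'' x -> C' x.

Section Reason.
Context {R : realType} {n : nat}.
Variables (rho : state R n) (r : 'I_n) (J : {set 'I_n}) (a : 'rV[R]_n) (b : R).

(* (r, J, a, b) encodes x_r + \sum_(j in J) a_j x_j >= b; the entries of a
   outside J are irrelevant. *)

(* The set is the continuous image of a nonempty compact box (up to the
   coordinates outside J, which do not matter), so this sup is a maximum. *)
Definition max_activity : R :=
  sup [set \sum_(j in J) a 0 j * x 0 j
      | x in [set x : 'rV[R]_n |
               forall j, j \in J -> lb rho 0 j <= x 0 j <= ub rho 0 j]].

Definition propagated_bound : R := b - max_activity.

Definition propagates : Prop :=
  lb rho 0 r = 0 /\ Num.ceil propagated_bound = 1.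

Definition non_tight : Prop := propagated_bound \isn't a Num.int.

Definition P_set : {set 'I_n} := [set j in J | ub rho 0 j == 1].
Definition PW_set : {set 'I_n} := [set j in P_set | a 0 j \isn't a Num.int].
Definition PZ_set : {set 'I_n} := [set j in P_set | a 0 j \is a Num.int].

Definition mir_coef (d t : R) : R :=
  (Num.floor t)%:~R + Num.min 1 (fractional_part t / fractional_part d).

Definition psi : R -> R := mir_coef (b - \sum_(j in P_set) a 0 j).
Definition psi_w : R -> R := mir_coef (b - \sum_(j in PW_set) a 0 j).

Definition cMIR : constraint R n :=
  [set x | x 0 r + \sum_(j in J :\: P_set) psi (a 0 j) * x 0 j
             - \sum_(j in P_set) psi (- a 0 j) * x 0 j
           >= 1 - \sum_(j in P_set) psi (- a 0 j)].

Definition wMIR : constraint R n :=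
  [set x | x 0 r + \sum_(j in PZ_set) a 0 j * x 0 j
             + \sum_(j in J :\: P_set) psi_w (a 0 j) * x 0 j
           >= (Num.ceil (b - \sum_(j in PW_set) a 0 j))%:~R].

End Reason.

(* Main.v *)
Require Import Defs.
From mathcomp Require Import all_boot all_order all_algebra archimedean.
From mathcomp Require Import classical_sets reals.
From mathcomp Require Import lra.

Import Order.TTheory GRing.Theory Num.Theory.
Local Open Scope ring_scope.

(** Write [P], [P_W], [P_Z] for the sets of the definitions and
    [K = \sum_(j in P_Z) a_j], an integer.  As [a >= 0], the activity of the
    reason constraint is largest at the local upper bounds, so the propagated
    bound is [beta = b - \sum_(j in P) a_j] ([max_activityE]), while
    [b - \sum_(j in P_W) a_j = beta + K] ([rhs_PW_shift]).  Consequently: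

    - the two right-hand sides have the same fractional part, so [psi] and
      [psi_w] are the same function, and the right-hand side of wMIR is
      [ceil (beta + K) = 1 + K], since propagation means [ceil beta = 1];
    - cMIR reads [x_r + \sum_(j in J \ P) psi(a_j) x_j
      + \sum_(j in P) psi(-a_j) (1 - x_j) >= 1], once the terms over [P] are
      complemented;
    - for [j] in [P_Z] the term is exactly [- a_j (1 - x_j)]
      ([mir_coef_int]), and these terms add up to [\sum a_j x_j - K];
    - for [j] in [P_W] one has [a_j > 0], so [psi(-a_j) <= 0]
      ([mir_coef_le0]), and the term is nonpositive on the unit box and can
      be dropped, which leaves wMIR. *)

Section MirCoef.
Variable R : realType.
Implicit Types d t k : R.

Lemma fractional_partDz t k :
  k \is a Num.int -> fractional_part (t + k) = fractional_part t.
Proof.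
move=> k_int; rewrite /fractional_part floorDrz // intrD.
by move: k_int; rewrite intrEfloor => /eqP ->; lra.
Qed.

Lemma mir_coef_int d k : k \is a Num.int -> mir_coef d k = k.
Proof.
rewrite intrEfloor /mir_coef /fractional_part => /eqP ->.
by rewrite subrr mul0r min_r ?ler01 // addr0.
Qed.

(** A negative argument has floor at most [-1], and the fractional
    correction adds at most [1]. *)
Lemma mir_coef_le0 d t : t < 0 -> mir_coef d t <= 0.
Proof.
rewrite -floor_lt0 /mir_coef -lezD1 => floor_t.
apply: (@le_trans _ _ ((Num.floor t)%:~R + 1)).
  by rewrite lerD2l ge_min lexx.
by rewrite -(intrD _ _ 1) lerz0.
Qed.

End MirCoef.

Section Reason.
Context {R : realType} {n : nat}.
Variables (rho : state R n) (J : {set 'I_n}) (a : 'rV[R]_n) (b : R).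
Hypothesis a_ge0 : forall j, j \in J -> 0 <= a 0 j.

Let P := P_set rho J.
Let PW := PW_set rho J a.
Let PZ := PZ_set rho J a.

Lemma big_P_split (F : 'I_n -> R) :
  \sum_(j in P) F j = \sum_(j in PZ) F j + \sum_(j in PW) F j.
Proof.
rewrite (bigID (fun j => a 0 j \is a Num.int)) /=.
by congr (_ + _); apply: eq_bigl => j; rewrite [in RHS]inE.
Qed.

Lemma sum_PZ_int : \sum_(j in PZ) a 0 j \is a Num.int.
Proof. by apply: rpred_sum => j; rewrite inE => /andP[]. Qed.

Lemma rhs_PW_shift :
  b - \sum_(j in PW) a 0 j
  = (b - \sum_(j in P) a 0 j) + \sum_(j in PZ) a 0 j.
Proof. by rewrite big_P_split; lra. Qed.

Lemma psi_w_eq t : psi_w rho J a b t = psi rho J a b t.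
Proof.
rewrite /psi_w /psi /mir_coef -/PW -/P rhs_PW_shift.
by rewrite fractional_partDz // sum_PZ_int.
Qed.

(** With nonnegative coefficients the vector of local upper bounds is a
    maximizer, and its entries on [J] are the indicator function of [P]. *)
Lemma max_activityE : max_activity rho J a = \sum_(j in P) a 0 j.
Proof.
have -> : \sum_(j in P) a 0 j = \sum_(j in J) a 0 j * ub rho 0 j.
  rewrite [RHS](big_setID P) /= [X in _ = _ + X]big1 ?addr0.
    apply: eq_big => j; first by rewrite !inE; case: (j \in J).
    by rewrite inE => /andP[_ /eqP ->]; rewrite mulr1.
  move=> j; rewrite !inE => /andP[+ jJ]; rewrite jJ /=.
  by case: (ub_binary rho j) => -> //; rewrite ?mulr0 // eqxx.
rewrite /max_activity; set S := (X in sup X).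
have S_ub : S (\sum_(j in J) a 0 j * ub rho 0 j).
  by exists (ub rho) => // j _; rewrite lb_le_ub lexx.
have ubS : ubound S (\sum_(j in J) a 0 j * ub rho 0 j).
  move=> _ [x x_box <-]; apply: ler_sum => j jJ.
  by rewrite ler_wpM2l ?a_ge0 //; have /andP[] := x_box j jJ.
apply/le_anti/andP; split.
  by apply: ge_sup => //; exists (\sum_(j in J) a 0 j * ub rho 0 j).
by apply: ub_le_sup => //; exists (\sum_(j in J) a 0 j * ub rho 0 j).
Qed.

(** An integral shift of the propagated bound, whose ceiling is [1]. *)
Lemma ceil_rhs_PW (r : 'I_n) : propagates rho r J a b ->
  (Num.ceil (b - \sum_(j in PW) a 0 j))%:~R = 1 + \sum_(j in PZ) a 0 j.
Proof.
case=> _; rewrite /propagated_bound max_activityE => ceil_beta.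
rewrite rhs_PW_shift ceilDrz ?sum_PZ_int // ceil_beta intrD ceil_floor.
rewrite sum_PZ_int addr0.
by have := sum_PZ_int; rewrite intrEfloor => /eqP ->.
Qed.

(** This is where rounding the [P_W] coefficients is seen to lose strength:
    on [P_Z] the terms of the two sides coincide, whereas the [P_W] terms of
    cMIR, of nonpositive coefficient once complemented, are replaced by 0. *)
Lemma complemented_terms_le x : global_box x ->
  \sum_(j in P) psi rho J a b (- a 0 j) * (1 - x 0 j)
  <= \sum_(j in PZ) a 0 j * x 0 j - \sum_(j in PZ) a 0 j.
Proof.
move=> x_box; rewrite big_P_split -sumrB -[leRHS]addr0; apply: lerD.
  apply: ler_sum => j; rewrite inE => /andP[_ aj_int].
  by rewrite /psi mir_coef_int ?rpredN //; lra.
apply: sumr_le0 => j; rewrite !inE => /andP[/andP[jJ _] aj_nint].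
have /andP[_ xj_le1] := x_box j.
rewrite mulr_le0_ge0 ?subr_ge0 // mir_coef_le0 // oppr_lt0 lt_def a_ge0 // andbT.
by apply: contraNneq aj_nint => ->; rewrite rpred0.
Qed.

End Reason.

Theorem proposition3 (R : realType) (n : nat) (rho : state R n)
    (r : 'I_n) (J : {set 'I_n}) (a : 'rV[R]_n) (b : R)
    (r_notin_J : r \notin J)
    (a_ge0 : forall j, j \in J -> 0 <= a 0 j)
    (prop_r : propagates rho r J a b)
    (prop_non_tight : non_tight rho J a b) :
  dominates (cMIR rho r J a b) (wMIR rho r J a b).
Proof.
move=> x x_box; rewrite /cMIR /wMIR /= (ceil_rhs_PW rho J a b a_ge0 r prop_r).
under [X in _ -> is_true (_ <= _ + X)]eq_bigr do rewrite psi_w_eq.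
have := complemented_terms_le rho J a b a_ge0 x x_box.
under [X in is_true (X <= _) -> _]eq_bigr do rewrite mulrBr mulr1.
by rewrite sumrB; lra.
Qed.
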